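(* Let $\mathbf{d}\in\mathcal{D}$ and $T=1$. Suppose that $\mathcal{F}=\mathcal{F}(\mathbf{d},1)$ and $\mathcal{G}=\mathcal{G}(\mathbf{d},1)$ are CIFSs, and suppose that $\mathcal{G}$ is a regular CIFS. Then $$\dim_H(J_{\mathcal{F}})>\dim_H(J_{\mathcal{G}}).$$
   Context: Notation. $\mathbb{N}$ is the set of positive integers, $\mathbb{D}=\{z\in\mathbb{C}:|z|<1\}$, $\mathbb{C}$ is identified with $\mathbb{R}^2$, $e(\theta)=e^{2\pi\sqrt{-1}\,\theta}$. $\dim_H$ is Hausdorff dimension. CIFS. Let $X\subset\mathbb{R}^d$ be compact and connected and $I$ a countable (possibly finite) set with at least two elements. A family $\mathcal{S}=\{s_i:X\to X\}_{i\in I}$ of injective contractions is an IFS if $\sup_{i}\mathrm{Lip}(s_i)<1$. For $\omega=(\omega_1,\dots,\omega_N)\in I^N$ put $s_\omega=s_{\omega_1}\circ\dots\circ s_{\omega_N}$. The limit set is $J_{\mathcal{S}}=\bigcup_{\omega\in I^{\mathbb{N}}}\bigcap_{N\ge1}s_{\omega|_N}(X)$, where $\omega|_N=(\omega_1,\dots,\omega_N)$. An IFS $\mathcal{S}$ is a conformal IFS (CIFS) if: (Open Set Condition) $s_i(\mathrm{Int}\,X)\cap s_j(\mathrm{Int}\,X)=\emptyset$ for $i\ne j$; (Cone Condition) there are $0<\alpha<\pi/2$, $l>0$ such that for every $x\in\partial X$ there is $u_x\neq0$ with $\{y:0<|y-x|<l,\ \langle y-x,u_x\rangle>|y-x||u_x|\cos\alpha\}\subset\mathrm{Int}(X)$;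 (Conformality) there is an open connected $V\supset X$ such that all $s_i$ extend to $C^{1+\varepsilon}$ diffeomorphisms on $V$ that are conformal on $V$; (Bounded Distortion) there is $K\ge1$ with $|s_\omega'(y)|\le K|s_\omega'(x)|$ for all $\omega\in\bigcup_N I^N$, $x,y\in V$, where $|s'_\omega(x)|$ is the operator norm of the derivative. Pressure and regularity. For a CIFS, $P_{\mathcal{S}}(t)=\lim_{N\to\infty}\frac1N\log\sum_{\omega\in I^N}\sup_{x\in X}|s_\omega'(x)|^t\in\mathbb{R}\cup\{\infty\}$ for $t\ge0$. $\mathcal{S}$ is regular if $P_{\mathcal{S}}(t)=0$ for some $t\ge0$. The systems. $\mathcal{D}$ is the set of real sequences $\{d_n\}_{n\ge1}$ with $d_1\ge2$ and $d_{n+1}-d_n\ge2$ for all $n$. For $\alpha\in\mathbb{C}$, $|\alpha|\ge2$, define $f_\alpha,g_\alpha:\overline{\mathbb{D}}\to\overline{\mathbb{D}}$ by $f_\alpha(z)=\frac{z+\overline{\alpha}}{|\alpha|^2-1}$, $g_\alpha(z)=\frac1{z+\alpha}$. For $\mathbf{d}=\{d_n\}\in\mathcal{D}$, $T\in\mathbb{N}$: $\mathcal{F}(\mathbf{d},T)=\{f_{e(j/T)d_n}:n\in\mathbb{N},\,j=0,\dots,T-1\}$ and $\mathcal{G}(\mathbf{d},T)=\{g_{e(j/T)d_n}:n\in\mathbb{N},\,j=0,\dots,T-1\}$, families of maps on $X=\overline{\mathbb{D}}$. *)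

(* Defs.v *)
From HB Require Import structures.
From mathcomp Require Import all_boot all_order all_algebra.
From mathcomp Require Import complex.
From mathcomp Require Import all_classical all_reals all_analysis.
Set Implicit Arguments.
Unset Strict Implicit.
Unset Printing Implicit Defensive.
Import Order.TTheory GRing.Theory Num.Theory.
Import numFieldNormedType.Exports.
Local Open Scope classical_set_scope.
Local Open Scope ring_scope.

(* R^k is 'rV[R]_k: the library topology
   and differential 'd are norm independent in finite dimension, but the library
   norm of 'rV[R]_k is the sup norm, so every metric notion below goes through
   the Euclidean norm [enorm]. *)

Section Euclidean.
Context {R : realType} {k : nat}.
Implicit Types (u v x : 'rV[R]_k) (A : set 'rV[R]_k) (f : 'rV[R]_k -> 'rV[R]_k).

Definition edot u v : R := \sum_(i < k) u ord0 i * v ord0 i.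
Definition enorm v : R := Num.sqrt (edot v v).

(* Meant for linear maps. *)
Definition opnorm f : R := sup [set enorm (f v) | v in [set v | enorm v <= 1]].

Definition Lip A f : \bar R :=
  ereal_sup [set (enorm (f p.1 - f p.2) / enorm (p.1 - p.2))%:E
            | p in [set p | [/\ A p.1, A p.2 & p.1 != p.2]]].

Definition ediam A : \bar R :=
  ereal_sup [set (enorm (p.1 - p.2))%:E | p in A `*` A].

Definition boundary A : set 'rV[R]_k := closure A `\` A°.

End Euclidean.

Section HausdorffDimension.
Context {R : realType} {k : nat}.
Implicit Types (A U : set 'rV[R]_k) (s delta : R).
Local Open Scope ereal_scope.

(* diam(U)^s, with diam(set0)^s = 0 for every s, including s = 0;
   for a one-point set and s = 0 the value is 0^0 = 1. *)
Definition diam_pow s U : \bar R :=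
  if `[< U = set0 >] then 0 else poweR (ediam U) s.

Definition hausdorff_pre s delta A : \bar R :=
  ereal_inf [set \sum_(n <oo) diam_pow s (U n)
            | U in [set U : nat -> set 'rV[R]_k |
                     A `<=` \bigcup_n U n /\
                     forall n, ediam (U n) <= delta%:E]].

Definition hausdorff_measure s A : \bar R :=
  ereal_sup [set hausdorff_pre s delta A | delta in [set delta | (0 < delta)%R]].

Definition hausdorff_dim A : \bar R :=
  ereal_inf [set s%:E | s in [set s | (0 <= s)%R /\ hausdorff_measure s A = 0]].

End HausdorffDimension.

Section CIFS.
Context {R : realType} {k : nat} {I : countType}.
Implicit Types (X V : set 'rV[R]_k) (s S : I -> 'rV[R]_k -> 'rV[R]_k).

(* A map X -> X is encoded by a total function, of which only the restriction
   to X is ever used. *)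
Record is_IFS X s : Prop := {
  ifs_compact : compact X;
  ifs_connected : connected X;
  ifs_index : exists i j : I, i != j;
  ifs_maps : forall i, s i @` X `<=` X;
  ifs_inj : forall i, {in X &, injective (s i)};
  ifs_contraction : (ereal_sup (range (fun i => Lip X (s i))) < 1)%E
}.

Definition word_map s (w : seq I) : 'rV[R]_k -> 'rV[R]_k :=
  foldr (fun i f => s i \o f) id w.

Definition limit_set X s : set 'rV[R]_k :=
  \bigcup_(w in [set: nat -> I])
    \bigcap_(N in [set N : nat | (0 < N)%N]) (word_map s (mkseq w N) @` X).

Definition open_set_condition X s : Prop :=
  forall i j, i != j -> (s i @` X°) `&` (s j @` X°) = set0.

Definition cone_condition X : Prop :=
  exists a l : R, [/\ 0 < a, a < pi / 2, 0 < l &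
    forall x, boundary X x -> exists2 u : 'rV[R]_k, u != 0 &
      [set y | [/\ 0 < enorm (y - x), enorm (y - x) < l &
                 enorm (y - x) * enorm u * cos a < edot (y - x) u]]
      `<=` X°].

(* f is of class C^{1+e} on the open set V: differentiable, with locally
   e-Hoelder derivative. *)
Definition C1_holder (e : R) V (f : 'rV[R]_k -> 'rV[R]_k) : Prop :=
  (forall x, V x -> differentiable f x) /\
  (forall x, V x -> exists C : R, exists2 U, nbhs x U &
     forall y z, U y -> V y -> U z -> V z ->
       opnorm (fun v => 'd f y v - 'd f z v) <= C * enorm (y - z) `^ e).

(* Diffeomorphism of V onto an open subset. *)
Definition C1_holder_diffeo (e : R) V (f : 'rV[R]_k -> 'rV[R]_k) : Prop :=
  [/\ C1_holder e V f, open (f @` V) &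
    exists2 g : 'rV[R]_k -> 'rV[R]_k, {in V, cancel f g} & C1_holder e (f @` V) g].

(* The derivative is a similarity at every point of V. *)
Definition conformal_on V (f : 'rV[R]_k -> 'rV[R]_k) : Prop :=
  forall x, V x -> exists2 r : R, 0 < r & forall v, enorm ('d f x v) = r * enorm v.

(* S is a family of extensions of the maps s to an open connected V.  The maps
   S i send V into V, so that the compositions [word_map S w], whose derivatives
   occur in [bounded_distortion], are defined on V. *)
Record conformal_extension X V s S : Prop := {
  ext_open : open V;
  ext_connected : connected V;
  ext_sub : X `<=` V;
  ext_eq : forall i x, X x -> S i x = s i x;
  ext_maps : forall i, S i @` V `<=` V;
  ext_diffeo : exists2 e : R, 0 < e & forall i, C1_holder_diffeo e V (S i);
  ext_conformal : forall i, conformal_on V (S i)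
}.

Definition bounded_distortion V S : Prop :=
  exists2 K : R, 1 <= K & forall (w : seq I) x y, w != [::] -> V x -> V y ->
    opnorm ('d (word_map S w) y) <= K * opnorm ('d (word_map S w) x).

Definition CIFS_extension X V s S : Prop :=
  [/\ is_IFS X s, open_set_condition X s, cone_condition X,
      conformal_extension X V s S & bounded_distortion V S].

Definition is_CIFS X s : Prop := exists V S, CIFS_extension X V s S.

Definition pressure_seq X S (t : R) (N : nat) : \bar R :=
  ((N%:R^-1)%:E *
   lne (\esum_(w in [set: N.-tuple I])
          ereal_sup [set (opnorm ('d (word_map S w) x) `^ t)%:E | x in X]))%E.

(* P_s(t) = p.  At x in X the derivatives of the maps [word_map S w] do not depend
   on the extension S: the extensions are C^1 and agree on the interior of X,
   which is dense in X by the cone condition. *)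
Definition is_pressure X s (t : R) (p : \bar R) : Prop :=
  exists V S, CIFS_extension X V s S /\ pressure_seq X S t @ \oo --> p.

Definition is_regular X s : Prop := exists2 t : R, 0 <= t & is_pressure X s t 0%E.

End CIFS.

Section Systems.
Context {R : realType}.

Definition C_of_R2 (v : 'rV[R]_2) : R[i] := Complex (v ord0 0) (v ord0 1).
Definition R2_of_C (z : R[i]) : 'rV[R]_2 :=
  \row_(j < 2) if j == 0 then complex.Re z else complex.Im z.

Definition closed_disc : set 'rV[R]_2 := [set v | enorm v <= 1].

Definition cis (theta : R) : R[i] :=
  Complex (cos (2 * pi * theta)) (sin (2 * pi * theta)).

Definition f_map (a z : R[i]) : R[i] := (z + a^*) / (`|a| ^+ 2 - 1).
Definition g_map (a z : R[i]) : R[i] := 1 / (z + a).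

(* Sequences are indexed from 0: [d n] stands for d_{n+1}. *)
Definition in_D (d : nat -> R) : Prop :=
  2 <= d 0%N /\ forall n, 2 <= d n.+1 - d n.

Definition param (d : nat -> R) (T : nat) (i : nat * 'I_T) : R[i] :=
  cis ((i.2)%:R / T%:R) * Complex (d i.1) 0.

Definition F_system (d : nat -> R) (T : nat) (i : nat * 'I_T)
  (v : 'rV[R]_2) : 'rV[R]_2 := R2_of_C (f_map (param d i) (C_of_R2 v)).

Definition G_system (d : nat -> R) (T : nat) (i : nat * 'I_T)
  (v : 'rV[R]_2) : 'rV[R]_2 := R2_of_C (g_map (param d i) (C_of_R2 v)).

End Systems.

(* Main.v *)
Require Import Defs.
From HB Require Import structures.
From mathcomp Require Import all_boot all_order all_algebra.
From mathcomp Require Import complex ring lra.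
From mathcomp Require Import all_classical all_reals all_analysis.
Set Implicit Arguments.
Unset Strict Implicit.
Unset Printing Implicit Defensive.
Import Order.TTheory GRing.Theory Num.Theory.
Import numFieldNormedType.Exports.
Import ComplexField.Normc.
Local Open Scope classical_set_scope.
Local Open Scope ring_scope.

(* For T = 1 the parameters are real, and f_n has ratio r_n = 1/(d_n^2 - 1).
   Composing the maps g_n on the half disc Re z >= 0, into which they send the
   whole disc, gives |g_w'| <= prod d_(w_i)^(-2).  By bounded distortion,
   P_G(h) = 0 forces 1 <= sum_n d_n^(-2h) < oo; the same bound, applied to the
   cover by the sets g_w(X), shows dim J_G <= t as soon as
   sum_n d_n^(-2t) < 1.  Let t0 be the supremum of the t >= h with
   sum_n d_n^(-2t) >= 1.  As r_n > d_n^(-2), a finite partial sum of the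
   r_n^(t0) exceeds 1, hence so does that of the r_n^(t1) for some t1 > t0.
   Finally dim J_F >= t1: the pieces f_n([0, 1]) are uniformly separated for
   n < M, so coding [0, 1] with weights proportional to r_n^(t1) provides an
   expanding Hoelder parametrization of a subset of J_F, and the subadditivity of
   Lebesgue measure on [0, 1] bounds its Hausdorff measure below. *)

(** * Sums over words *)

Section Sums.
Context {R : realType}.
Local Open Scope ereal_scope.

Lemma esum_ge1 (T : choiceType) (S : set T) (f : T -> \bar R) i :
  (forall j, 0 <= f j) -> S i -> f i <= \esum_(j in S) f j.
Proof.
move=> f0 Si; apply: esum_ge; exists [set i]; last by rewrite fsbig_set1.
by split; [exact: finite_set1|move=> _ ->].
Qed.

(** For finite c > 0 one inequality suffices, since the converse is the same inequality for 1/c. For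
    c = +oo, either some term is positive and both sides are infinite, or every term vanishes. *)
Lemma ge0_esumZl (T : choiceType) (S : set T) (c : \bar R) (f : T -> \bar R) :
  0 <= c -> (forall i, 0 <= f i) ->
  \esum_(i in S) (c * f i) = c * \esum_(i in S) f i.
Proof.
move=> c0 f0; have Ef0 : 0 <= \esum_(i in S) f i by apply: esum_ge0.
have cf0 (x : \bar R) i : 0 <= x -> 0 <= x * f i by move=> x0; exact: mule_ge0.
have le_fin (x : R) (g : T -> \bar R) : (0 <= x)%R -> (forall i, 0 <= g i) ->
    \esum_(i in S) (x%:E * g i) <= x%:E * \esum_(i in S) g i.
  move=> x0 g0; apply: ge_ereal_sup => _ [A [finA AS] <-].
  rewrite -ge0_mule_fsumr//.
  by rewrite lee_wpmul2l ?lee_fin//; apply: ereal_sup_ubound; exists A.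
case: c c0 cf0 => [c| |//] c0 cf0.
  have [->|cn0] := eqVneq c 0%R.
    by rewrite mul0e esum1// => i; rewrite mul0e.
  apply/eqP; rewrite eq_le le_fin//=.
  have := le_fin c^-1%R (fun i => c%:E * f i); rewrite invr_ge0 => /(_ c0).
  move=> /(_ (fun i => cf0 c%:E i c0)).
  under eq_esum do rewrite muleA -EFinM mulVf// mul1e.
  move=> /(lee_wpmul2l c0); rewrite muleA -EFinM divff// mul1e; exact.
have [[i Si fi]|nf] := pselect (exists2 i, S i & 0 < f i).
  have E0 := lt_le_trans fi (esum_ge1 f0 Si).
  rewrite gt0_mulye//; apply/eqP; rewrite -leye_eq.
  have := @esum_ge1 _ S (fun i => +oo * f i) i (fun j => cf0 +oo j c0) Si.
  by rewrite gt0_mulye.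
have f00 i : S i -> f i = 0.
  move=> Si; apply/eqP; rewrite eq_le f0 andbT leNgt.
  by apply/negP => fi; apply: nf; exists i.
by rewrite !esum1 ?mule0// => i /f00 ->; rewrite mule0.
Qed.

(** Induction on N, splitting a word into its first letter and the rest. All terms are nonnegative,
    so the identity also covers divergent sums. *)
Lemma esum_tuple_prod (I : countType) (a : I -> R) (N : nat) :
  (forall i, 0 <= a i)%R ->
  \esum_(w in [set: N.-tuple I]) (\prod_(i <- w) a i)%:E =
  (\esum_(i in [set: I]) (a i)%:E) ^+ N.
Proof.
move=> a0; have a0E i : 0 <= (a i)%:E by rewrite lee_fin.
have p0 N' (w : N'.-tuple I) : 0 <= (\prod_(i <- w) a i)%:E.
  by rewrite lee_fin; apply: prodr_ge0 => i _; exact: a0.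
elim: N => [|N IH].
  rewrite expe0 (_ : [set: 0.-tuple I] = [set [tuple]]).
    by rewrite esum_set1 ?big_nil// lee_fin.
  by apply/seteqP; split => w _ //=; rewrite tuple0.
have bij : set_bij ([set: I] `*` [set: N.-tuple I]) [set: N.+1.-tuple I]
    (fun p => [tuple of p.1 :: p.2]).
  split=> //.
  - move=> [i w] [j v] _ _ /= /(congr1 val)/= [-> wv].
    by congr (_, _); apply/val_inj.
  - move=> w _ /=; exists (thead w, [tuple of behead w]) => //=.
    by rewrite [RHS]tuple_eta.
rewrite (reindex_esum _ _ _ _ bij).
have -> : [set: I] `*` [set: N.-tuple I] =
    [set: I] `*`` (fun=> [set: N.-tuple I]) by apply/seteqP; split.
rewrite -(@esum_esum _ _ _ _ _ (fun i (w : N.-tuple I) =>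
    (\prod_(j <- [tuple of i :: w]) a j)%:E)); last by move=> *; exact: p0.
under eq_esum => i _.
  rewrite (_ : esum _ _ = (\esum_(i in [set: I]) (a i)%:E) ^+ N * (a i)%:E).
    over.
  rewrite -IH [RHS]muleC -ge0_esumZl//.
  by apply: eq_esum => w _; rewrite big_cons EFinM.
rewrite ge0_esumZl//; first by rewrite expeS muleC.
by apply: expe_ge0; exact: esum_ge0.
Qed.

(** The covers in [hausdorff_pre] are indexed by integers; this turns the series of a cover
    enumerated through [pickle_inv] into a sum over words. *)
Lemma nneseries_pickle (I : countType) (f : I -> \bar R) :
  (forall i, 0 <= f i) ->
  \sum_(n <oo) (if pickle_inv n is Some i then f i else 0) =
  \esum_(i in [set: I]) f i.
Proof.
move=> f0; pose g n := if pickle_inv n is Some i then f i else 0.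
have g0 n : 0 <= g n by rewrite /g; case: pickle_inv.
rewrite -/g nneseries_esumT//.
transitivity (\esum_(n in @pickle I @` setT) g n).
  rewrite [RHS]esum_mkcond; apply: eq_esum => n _; case: ifPn => // nP.
  rewrite /g; case En: pickle_inv => [i|//]; case/negP: nP; apply/mem_set.
  by exists i => //; have := @pickle_invK I n; rewrite En.
rewrite esum_image; last by move=> i j _ _; exact: (pcan_inj pickleK_inv).
by apply: eq_esum => i _; rewrite /g pickleK_inv.
Qed.

Lemma esum_fst_ord1 (f : nat -> \bar R) : (forall n, 0 <= f n) ->
  \esum_(i in [set: nat * 'I_1]) f i.1 = \sum_(n <oo) f n.
Proof.
move=> f0; rewrite nneseries_esumT//.
rewrite (reindex_esum [set: nat] [set: nat * 'I_1] (fun n => (n, ord0)))//.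
split=> // [m n _ _ []//|[n j] _]; exists n => //; congr (_, _).
by rewrite (ord1 j).
Qed.

Lemma powR_prod (I : Type) (r : seq I) (a : I -> R) (t : R) :
  (forall i, 0 <= a i)%R ->
  ((\prod_(i <- r) a i) `^ t = \prod_(i <- r) a i `^ t)%R.
Proof.
move=> a0; elim: r => [|i r IH]; first by rewrite !big_nil powR1.
by rewrite !big_cons powRM ?IH//; apply: prodr_ge0.
Qed.

Lemma esum_word_powR (a : nat -> R) (t : R) N : (forall n, 0 <= a n)%R ->
  \esum_(w in [set: N.-tuple (nat * 'I_1)]) ((\prod_(i <- w) a i.1) `^ t)%:E =
  (\sum_(n <oo) (a n `^ t)%:E) ^+ N.
Proof.
move=> a0; under eq_esum do rewrite powR_prod//.
rewrite (esum_tuple_prod _ (fun i => powR_ge0 (a i.1) t)).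
rewrite (esum_fst_ord1 (f := fun n => (a n `^ t)%:E))//.
by move=> n; rewrite lee_fin powR_ge0.
Qed.

End Sums.

(** * Comparison of the critical exponents of two series *)

Section Exponents.
Context {R : realType}.

Lemma continuous_powR_exp (a : R) : 0 < a -> continuous (fun t => a `^ t).
Proof.
move=> a0; have -> : (fun t => a `^ t) = expR \o (fun t => t * ln a).
  by apply/funext => t; rewrite /powR gt_eqF.
move=> t; apply: continuous_comp; first exact: mulrr_continuous.
exact: continuous_expR.
Qed.

Lemma continuous_sum_powR (a : nat -> R) M : (forall n, 0 < a n) ->
  continuous (fun t => \sum_(n < M) a n `^ t).
Proof.
move=> a0; apply: continuous_big => [|n _]; first exact: add_continuous.
exact: continuous_powR_exp.
Qed.

(** The series of a may jump down to the right of no point of interest, but only finite sums are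
    known to be continuous here. So the argument at t0 runs on a partial sum: it loses at most half
    of what replacing a 0 by b 0 gains, and the surplus persists slightly to the right of t0. *)
Lemma exponent_gap (a b : nat -> R) (h : R) : 0 < h ->
  (forall n, 0 < a n <= 1/4) -> (forall n, a n <= b n) -> a 0%N < b 0%N ->
  (\sum_(n <oo) (a n `^ h)%:E < +oo)%E ->
  (1 <= \sum_(n <oo) (a n `^ h)%:E)%E ->
  exists t0 t1 M, [/\ h <= t0, t0 < t1, 1 <= \sum_(n < M) b n `^ t1 &
    forall t, t0 < t -> (\sum_(n <oo) (a n `^ t)%:E < 1)%E].
Proof.
move=> h0 a14 ab ab0 hoo h1.
have a0 n : 0 < a n by case/andP: (a14 n).
have b0 n : 0 < b n by exact: lt_le_trans (a0 n) (ab n).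
have aE0 t n : (0 <= (a n `^ t)%:E)%E by rewrite lee_fin powR_ge0.
set psi := fun t => (\sum_(n <oo) (a n `^ t)%:E)%E.
have psi_anti t u : t <= u -> (psi u <= psi t)%E.
  move=> tu; apply: lee_nneseries => // n _; rewrite lee_fin ger_powR// a0/=.
  by have /andP[_] := a14 n; lra.
have psi0 t : (0 <= psi t)%E by apply: nneseries_ge0 => *; exact: aE0.
pose A := [set t | h <= t /\ (1 <= psi t)%E].
have Ah : A h by split.
(* Since a n <= 1/4, raising the exponent by k multiplies the series by at most 4^-k; this bounds
   the set [A]. *)
have [k Ak] : exists k : nat, (psi (h + k%:R)%R < 1)%E.
  have [p pE] : exists p, psi h = p%:E.
    by exists (fine (psi h)); rewrite fineK// ge0_fin_numE// psi0.
  have p0 : 0 < p by rewrite -lte_fin -pE (lt_le_trans _ h1).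
  have : (4^-1 ^+ n : R) @[n --> \oo] --> 0.
    by apply: cvg_expr; rewrite ger0_norm ?invr_ge0//; lra.
  move/cvgrPdist_lt => /(_ p^-1); rewrite invr_gt0 => /(_ p0).
  move=> [k _ /(_ k (leqnn _))].
  rewrite /= sub0r normrN ger0_norm; last by rewrite exprn_ge0 ?invr_ge0.
  move=> hk; exists k; apply: (@le_lt_trans _ _ ((4^-1 ^+ k)%:E * psi h)%E).
    rewrite /psi -nneseriesZl//; apply: lee_nneseries => // n _.
    rewrite -EFinM lee_fin mulrC powRD; last first.
      by apply/implyP => _; rewrite gt_eqF.
    rewrite ler_wpM2l ?powR_ge0// powR_mulrn ?(ltW (a0 n))//.
    have n4 : a n <= 4^-1 by have /andP[_] := a14 n; lra.
    by rewrite lerXn2r ?nnegrE ?invr_ge0// ltW.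
  by rewrite pE -EFinM lte_fin -ltr_pdivlMr// mul1r.
have ubA : ubound A (h + k%:R).
  move=> t [_ t1]; rewrite leNgt; apply/negP => /ltW /psi_anti /(le_trans t1).
  by rewrite leNgt Ak.
have hsA : has_sup A.
  split; [exists h; exact: Ah | exists (h + k%:R); exact: ubA].
pose t0 := sup A.
have A_le t : A t -> t <= t0 by apply: ub_le_sup; case: hsA.
have ht0 : h <= t0 by exact: A_le.
have lt1 t : t0 < t -> (psi t < 1)%E.
  move=> t0t; rewrite ltNge; apply/negP => t1.
  have : t <= t0 by apply: A_le; split=> //; lra.
  by lra.
(* The gain in the first term; half of it pays for the tail of the series. *)
pose dl := b 0%N `^ t0 - a 0%N `^ t0.
have dl0 : 0 < dl.
  by rewrite subr_gt0 gt0_ltr_powR ?nnegrE//; [lra | exact: ltW..].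
(* The tail is cut at exponent h; since a n <= 1, the same M then serves every t >= h. *)
have [M HM] : exists M, (\sum_(M.+1 <= n <oo) (a n `^ h)%:E <= (dl / 2)%:E)%E.
  have := nneseries_tail_cvg hoo (fun n _ => aE0 h n).
  move/fine_cvgP => [] [K _ HK] /cvgrPdist_lt /(_ (dl / 2)).
  rewrite divr_gt0// => /(_ isT) [K' _ HK'].
  exists (maxn K K'); have := HK (maxn K K').+1 (leqW (leq_maxl _ _)).
  have := HK' (maxn K K').+1 (leqW (leq_maxr _ _)); rewrite /= sub0r normrN.
  move=> + f; rewrite -{2}(fineK f) lee_fin => /ltW; exact/le_trans/ler_norm.
pose S (c : nat -> R) t := \sum_(n < M.+1) c n `^ t.
have psiS t : h <= t -> (psi t <= (S a t + dl / 2)%:E)%E.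
  move=> ht; rewrite /psi (nneseries_split 0 M.+1)// add0n EFinD.
  rewrite leeD//; first by rewrite /S -sumEFin big_mkord.
  apply: le_trans HM; apply: lee_nneseries => // n _.
  by rewrite lee_fin ger_powR// a0/=; have /andP[_] := a14 n; lra.
(* Otherwise, by continuity of the partial sum, some t in [A] close to t0 would have S a t < 1 - dl
   / 2, hence psi t < 1. *)
have St0 : 1 - dl / 2 <= S a t0.
  rewrite leNgt; apply/negP => Slt.
  have := @continuous_sum_powR a M.+1 a0 t0.
  move=> /cvgrPdist_lt /(_ (1 - dl / 2 - S a t0)); rewrite subr_gt0 => /(_ Slt).
  move=> [e /= e0 He]; have [t [ht t1] tt0] := sup_adherent e0 hsA.
  have tle : t <= t0 by exact: A_le.
  have := He t; rewrite /ball_/= -/t0 ger0_norm; last by lra.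
  move=> /(_ _)/=; rewrite -/(S a t) -/(S a t0) => H.
  have {}H := H _; have : `|S a t0 - S a t| < 1 - dl / 2 - S a t0.
    by apply: H; move: tt0; rewrite -/t0; lra.
  rewrite ltr_norml => /andP[H1 _].
  have := le_trans t1 (psiS t ht); rewrite lee_fin; lra.
have Sb : 1 < S b t0.
  apply: (@lt_le_trans _ _ (S a t0 + dl)); first by lra.
  rewrite /S !big_ord_recl /= addrAC lerD//.
    by rewrite /dl addrCA subrr addr0.
  apply: ler_sum => n _.
  by rewrite ge0_ler_powR ?nnegrE ?(ltW (a0 _)) ?(ltW (b0 _))//; lra.
have := @continuous_sum_powR b M.+1 b0 t0.
move=> /cvgrPdist_lt /(_ (S b t0 - 1)); rewrite subr_gt0 => /(_ Sb).
move=> [e /= e0 He].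
exists t0, (t0 + e / 2), M.+1; split => //; first by lra.
have := He (t0 + e / 2); rewrite /ball_/= opprD addrA subrr sub0r normrN.
rewrite ger0_norm; last by lra.
have e2 : e / 2 < e by lra.
move=> /(_ e2); rewrite -/(S b _) -/(S b t0) ltr_norml; lra.
Qed.

End Exponents.

(** * Lower bounds by Hoelder coding *)

Section HolderParametrization.
Context {R : realType} {k : nat}.
Implicit Types (J U : set 'rV[R]_k).

Lemma diam_pow_ge0 s U : (0 <= diam_pow s U)%E.
Proof. by rewrite /diam_pow; case: ifP => // _; exact: poweR_ge0. Qed.

Lemma enorm_le_ediam U u v : U u -> U v ->
  ((enorm (u - v))%:E <= ediam U)%E.
Proof. by move=> Uu Uv; apply: ereal_sup_ubound; exists (u, v). Qed.

Lemma enormB_ge0 (u v : 'rV[R]_k) : 0 <= enorm (u - v).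
Proof. exact: sqrtr_ge0. Qed.

(** A form of the mass distribution principle: the preimage under X of a set of diameter D lies in
    an interval of length at most 2 K D^s. These intervals cover [0, 1], so the sum of D^s over any
    cover is at least 1 / (2 K). Passing to intervals also avoids any question of measurability of
    preimages. *)
Lemma hausdorff_measure_holder_neq0 J (X : R -> 'rV[R]_k) (K s : R) :
  0 < K -> 0 <= s -> (forall y, 0 <= y <= 1 -> J (X y)) ->
  (forall y y', 0 <= y <= 1 -> 0 <= y' <= 1 ->
     `|y - y'| <= K * enorm (X y - X y') `^ s) ->
  hausdorff_measure s J != 0%E.
Proof.
move=> K0 s0 XJ Hol; rewrite gt_eqF//.
apply: (@lt_le_trans _ _ ((2 * K)^-1)%:E).
  by rewrite lte_fin invr_gt0 mulr_gt0.
(* One scale is enough below a supremum; delta = 1 keeps all diameters finite. *)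
apply: (@le_trans _ _ (hausdorff_pre s 1 J)); last first.
  by apply: ereal_sup_ubound; exists 1 => //=.
apply: le_ereal_inf_tmp => _ [U [JU U1] <-].
pose E n := [set y : R | 0 <= y <= 1 /\ U n (X y)].
have cover n : exists I : set R, [/\ measurable I, E n `<=` I &
    (lebesgue_measure I <= (2 * K)%:E * diam_pow s (U n))%E].
  have [[y [y01 Uy]]|nE] := pselect (E n !=set0); last first.
    exists set0; split => //; first by move=> y Ey; apply: nE; exists y.
    by rewrite measure0 mule_ge0 ?diam_pow_ge0// lee_fin mulr_ge0// ltW.
  have U0 : U n <> set0 by move=> U0; move: Uy; rewrite U0.
  rewrite /diam_pow; case: asboolP => // _.
  have D0 : (0 <= ediam (U n))%E.
    by apply: le_trans (enorm_le_ediam Uy Uy); rewrite lee_fin enormB_ge0.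
  have [D DE] : exists D, ediam (U n) = D%:E.
    exists (fine (ediam (U n))); rewrite fineK// ge0_fin_numE//.
    exact: le_lt_trans (U1 n) (ltry _).
  move: D0; rewrite DE lee_fin => D0; rewrite poweR_EFin.
  set e := K * D `^ s; have e0 : 0 <= e by rewrite mulr_ge0 ?powR_ge0// ltW.
  (* Centred at an arbitrary point y of [E n]: all other points are within e of it. *)
  exists `[y - e, y + e]%classic; split => //.
    move=> z [z01 Uz]; rewrite /= in_itv/= -ler_distlC.
    rewrite (le_trans (Hol _ _ y01 z01))// ler_wpM2l ?(ltW K0)//.
    rewrite ge0_ler_powR ?nnegrE ?enormB_ge0//.
    by have := enorm_le_ediam Uy Uz; rewrite DE lee_fin.
  rewrite lebesgue_measure_itv/= lte_fin; case: ifP => _.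
    by rewrite -EFinB -EFinM lee_fin /e; lra.
  by rewrite -EFinM lee_fin -mulrA mulr_ge0.
have [I HI] := choice cover.
have : (1 <= (2 * K)%:E * \sum_(n <oo) diam_pow s (U n))%E.
  apply: (@le_trans _ _ (lebesgue_measure (`[0, 1]%classic : set R))).
    by rewrite lebesgue_measure_itv/= lte_fin ltr01 oppr0 adde0.
  apply: (@le_trans _ _ (\sum_(n <oo) lebesgue_measure (I n))%E).
    apply: measure_sigma_subadditive => //; first by move=> n; case: (HI n).
    move=> y; rewrite /= in_itv/= => y01; have [n _ Un] := JU _ (XJ _ y01).
    by exists n => //; case: (HI n) => _ + _; apply.
  rewrite -nneseriesZl; last by move=> n _; exact: diam_pow_ge0.
  by apply: lee_nneseries => n _ //; case: (HI n).
move=> H; rewrite -(@lee_pmul2l _ (2 * K)%:E) ?lte_fin ?mulr_gt0//.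
by rewrite -EFinM divff// gt_eqF// mulr_gt0.
Qed.

End HolderParametrization.

(** * Coding [0, 1] by finitely many separated affine contractions *)

Section Coding.
Context {R : realType} (M : nat) (r c p : nat -> R) (g q s : R).
Hypotheses (r0 : forall i, (i < M)%N -> 0 < r i)
  (c0 : forall i, (i < M)%N -> 0 <= c i)
  (rc1 : forall i, (i < M)%N -> r i + c i <= 1)
  (g0 : 0 < g) (s0 : 0 <= s)
  (gap : forall i j x y, (i < M)%N -> (j < M)%N -> i <> j ->
    0 <= x <= 1 -> 0 <= y <= 1 ->
    g <= `|(r i * x + c i) - (r j * y + c j)|)
  (p0 : forall i, 0 < p i) (pq : forall i, p i <= q) (q1 : q < 1)
  (pr : forall i, (i < M)%N -> p i <= r i `^ s)
  (p1 : \sum_(i < M) p i = 1).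

(** Consecutive intervals of lengths p 0, ..., p m tile the range of y; i names the tile of y and z
    is the rescaled position in it. A common endpoint goes to the left tile. *)
Lemma weight_digit m y : 0 <= y <= \sum_(i < m.+1) p i ->
  exists i z, [/\ (i < m.+1)%N, 0 <= z <= 1 & y = \sum_(j < i) p j + p i * z].
Proof.
have step n x : 0 <= x <= p n -> exists2 z, 0 <= z <= 1 & x = p n * z.
  move=> /andP[x0 xp]; exists (x / p n); last by rewrite mulrC divfK// gt_eqF.
  by rewrite divr_ge0 ?(ltW (p0 n))//= ler_pdivrMr// mul1r.
elim: m y => [|m IH] y.
  rewrite big_ord1 => /step[z z01 ->]; exists 0%N, z; split => //.
  by rewrite big_ord0 add0r.
rewrite big_ord_recr /= => /andP[y0 y1].
have [ym|my] := leP y (\sum_(i < m.+1) p i).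
  have [|i [z [im z01 ->]]] := IH y; first by rewrite y0.
  by exists i, z; split=> //; exact: leqW.
have [|z z01 yE] := step m.+1 (y - \sum_(i < m.+1) p i); first by lra.
by exists m.+1, z; split=> //; rewrite -yE addrC subrK.
Qed.

(** [T] is the expanding map of [0, 1] with affine branches of slopes 1 / p i, and [dig] reads the
    first digit of the resulting expansion. *)
Lemma weight_shift : exists (dig : R -> nat) (T : R -> R), forall y,
  0 <= y <= 1 -> [/\ (dig y < M)%N, 0 <= T y <= 1 &
    y = \sum_(j < dig y) p j + p (dig y) * T y].
Proof.
have M0 : (0 < M)%N.
  by case: M p1 => //; rewrite big_ord0 => /esym/eqP; rewrite oner_eq0.
have /choice[dT H] : forall y, exists dT : nat * R, 0 <= y <= 1 ->
    [/\ (dT.1 < M)%N, 0 <= dT.2 <= 1 &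
    y = \sum_(j < dT.1) p j + p dT.1 * dT.2].
  move=> y; have [y01|_] := boolP (0 <= y <= 1); last by exists (0%N, 0).
  have [|i [z [im z01 yE]]] := @weight_digit M.-1 y.
    by rewrite prednK// p1.
  by exists (i, z) => _; split => //=; move: im; rewrite prednK.
by exists (fun y => (dT y).1), (fun y => (dT y).2).
Qed.

(** The first n digits of y select n affine maps, whose composition is applied to 0. These values
    increase with n because the maps are increasing and send 0 to c i >= 0; their limit is X y. *)
Lemma coding_point (dig : R -> nat) (T : R -> R) :
  (forall y, 0 <= y <= 1 -> (dig y < M)%N /\ 0 <= T y <= 1) ->
  exists X : R -> R, forall y, 0 <= y <= 1 ->
    0 <= X y <= 1 /\ X y = r (dig y) * X (T y) + c (dig y).
Proof.
move=> dT.
pose XN := fix XN n y :=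
  if n is m.+1 then r (dig y) * XN m (T y) + c (dig y) else 0.
have XN01 n y : 0 <= y <= 1 -> 0 <= XN n y <= 1.
  elim: n y => [|n IH] y y01 /=; first by rewrite lexx ler01.
  have [dM Ty] := dT y y01; have /andP[X0 X1] := IH _ Ty.
  have rd := r0 dM; have cd := c0 dM; have rcd := rc1 dM.
  rewrite addr_ge0 ?mulr_ge0 ?(ltW rd)//= (le_trans _ rcd)// lerD2r.
  by rewrite -[leRHS]mulr1 ler_wpM2l ?(ltW rd).
have XNS n y : 0 <= y <= 1 -> XN n y <= XN n.+1 y.
  elim: n y => [|n IH] y y01; first by have /andP[] := XN01 1%N y y01.
  have [dM Ty] := dT y y01.
  by rewrite /= lerD2r ler_wpM2l ?(ltW (r0 dM))//; exact: IH.
have cvgX y : 0 <= y <= 1 -> cvg (XN n y @[n --> \oo]).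
  move=> y01; apply: nondecreasing_is_cvgn.
    by apply/nondecreasing_seqP => n; exact: XNS.
  by exists 1 => _ [n _ <-]; have /andP[] := XN01 n y y01.
exists (fun y => lim (XN n y @[n --> \oo])) => y y01; split.
  apply/andP; split.
    apply: limr_ge; [exact: cvgX|apply: nearW => n].
    by have /andP[] := XN01 n y y01.
  apply: limr_le; [exact: cvgX|apply: nearW => n].
  by have /andP[] := XN01 n y y01.
have [dM Ty] := dT y y01.
(* Dropping the first term exposes XN n.+1 y = r * XN n (T y) + c, and the limit is taken on both
   sides. *)
apply/cvg_lim => //; rewrite -(cvg_shiftS (XN^~ y))/=.
by apply: cvgD; [apply: cvgM; [exact: cvg_cst|exact: cvgX]|exact: cvg_cst].
Qed.

(** Distinct first digits put the points X y and X y' at distance at least g, and K = g^(-s) makes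
    the right side at least 1. With a common digit i the left side scales by p i and the right side
    by r i ^ s >= p i, so the bound passes from the shifted points to y and y'. *)
Lemma coding_holder : exists (dig : R -> nat) (T X : R -> R) (K : R), [/\ 0 < K,
  forall y, 0 <= y <= 1 -> [/\ (dig y < M)%N, 0 <= T y <= 1, 0 <= X y <= 1 &
    X y = r (dig y) * X (T y) + c (dig y)] &
  forall y y', 0 <= y <= 1 -> 0 <= y' <= 1 ->
    `|y - y'| <= K * `|X y - X y'| `^ s].
Proof.
have [dig [T dT]] := weight_shift.
have [|X HX] := @coding_point dig T; first by move=> y /dT[].
have q0 : 0 < q := lt_le_trans (p0 0) (pq 0).
pose K := (g `^ s)^-1; have gs0 : 0 < g `^ s by exact: powR_gt0.
have K0 : 0 < K by rewrite invr_gt0.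
exists dig, T, X, K; split => //.
  by move=> y y01; have [? ? _] := dT y y01; have [] := HX y y01.
(* The error q ^+ n accounts for pairs that still share their first n digits, perhaps all digits; it
   is removed by letting n grow. *)
have approx n y y' : 0 <= y <= 1 -> 0 <= y' <= 1 ->
    `|y - y'| <= K * `|X y - X y'| `^ s + q ^+ n.
  elim: n y y' => [|n IH] y y' y01 y01'.
    rewrite expr0 (@le_trans _ _ 1)//; first by rewrite ler_norml; lra.
    by rewrite lerDr mulr_ge0 ?powR_ge0// ltW.
  have [dM Ty yE] := dT y y01; have [X01 XE] := HX y y01.
  have [dM' Ty' yE'] := dT y' y01'; have [X01' XE'] := HX y' y01'.
  have [dE|dE] := eqVneq (dig y) (dig y'); last first.
    apply: (@le_trans _ _ 1); first by rewrite ler_norml; lra.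
    apply: (@le_trans _ _ (K * `|X y - X y'| `^ s)); last first.
      by rewrite lerDl exprn_ge0// ltW.
    rewrite -[leLHS](mulVf (negbT (gt_eqF gs0))) ler_wpM2l ?(ltW K0)//.
    rewrite ge0_ler_powR ?nnegrE ?(ltW g0)// XE XE' gap//; first exact/eqP.
    - by have [] := HX _ Ty.
    - by have [] := HX _ Ty'.
  rewrite {1}yE {1}yE' XE XE' -dE.
  rewrite [X in `|X|](_ : _ = p (dig y) * (T y - T y')); last by ring.
  rewrite [X in `|X| `^ _](_ : _ = r (dig y) * (X (T y) - X (T y'))).
    2: by ring.
  rewrite !normrM (gtr0_norm (p0 _)) (gtr0_norm (r0 dM)).
  rewrite powRM ?(ltW (r0 dM))//.
  apply: (@le_trans _ _
    (p (dig y) * (K * `|X (T y) - X (T y')| `^ s + q ^+ n))).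
    by rewrite ler_wpM2l ?(ltW (p0 _))// IH.
  rewrite mulrDr lerD//.
    by rewrite mulrCA ler_wpM2l ?(ltW K0)// ler_wpM2r ?powR_ge0// pr.
  by rewrite exprS ler_wpM2r ?exprn_ge0 ?(ltW q0).
move=> y y' y01 y01'; apply/ler_addgt0Pr => e e0.
have : (q ^+ n) @[n --> \oo] --> (0 : R) by apply: cvg_expr; rewrite gtr0_norm.
move/cvgrPdist_lt => /(_ e e0) [n _ /(_ n (leqnn _))].
rewrite /= sub0r normrN => /ltW qe.
rewrite (le_trans (approx n y y' y01 y01'))// lerD2l.
exact: le_trans (ler_norm _) qe.
Qed.

End Coding.

(** * The maps g_n *)

Section Plane.
Context {R : realType}.
Implicit Types (u v : 'rV[R]_2) (z : R[i]).

Lemma enormE v : enorm v = Num.sqrt (v ord0 0 ^+ 2 + v ord0 1 ^+ 2).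
Proof.
rewrite /enorm /edot big_ord_recl big_ord1 !expr2.
by congr (Num.sqrt (_ * _ + v _ _ * v _ _)); apply/val_inj.
Qed.

Lemma enorm_normc v : enorm v = normc (C_of_R2 v).
Proof. by rewrite enormE. Qed.

Lemma closed_discE v : closed_disc v = (normc (C_of_R2 v) <= 1 : Prop).
Proof. by rewrite -enorm_normc. Qed.

Lemma enorm_ge0 v : 0 <= enorm v.
Proof. exact: sqrtr_ge0. Qed.

Lemma enorm0 : enorm (0 : 'rV[R]_2) = 0.
Proof. by rewrite enormE !mxE expr0n addr0 sqrtr0. Qed.

Lemma C_of_R2B u v : C_of_R2 (u - v) = C_of_R2 u - C_of_R2 v.
Proof. by apply/eqP; rewrite eq_complex /= !mxE !eqxx. Qed.

Lemma R2_of_CK z : C_of_R2 (R2_of_C z) = z.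
Proof. by case: z => a b; rewrite /C_of_R2 /R2_of_C !mxE. Qed.

Lemma enormZ r v : enorm (r *: v) = `|r| * enorm v.
Proof.
by rewrite !enormE !mxE !exprMn -mulrDr sqrtrM ?sqr_ge0// sqrtr_sqr.
Qed.

Lemma le_enormB u v : enorm (u - v) <= enorm u + enorm v.
Proof.
rewrite !enorm_normc C_of_R2B.
by rewrite (le_trans (le_normcD _ _))// normcN.
Qed.

Lemma normc_ge_Re z : `|complex.Re z| <= normc z.
Proof.
by case: z => a b /=; rewrite -sqrtr_sqr ler_wsqrtr// lerDl sqr_ge0.
Qed.

Lemma normc_ge0 z : 0 <= normc z.
Proof. by case: z => a b; exact: sqrtr_ge0. Qed.

End Plane.

Lemma word_map_rcons {R : realType} k (I : countType)
    (s : I -> 'rV[R]_k -> 'rV[R]_k) w i v :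
  word_map s (rcons w i) v = word_map s w (s i v).
Proof. by elim: w => //= j w ->. Qed.

Section InversionMaps.
Context {R : realType} (d : nat -> R).
Implicit Types (u v : 'rV[R]_2).
Hypothesis hd : in_D d.

Lemma in_D_add m n : (m < n)%N -> d m + 2 <= d n.
Proof.
case: hd => _ h; elim: n => // n IH; rewrite ltnS leq_eqVlt => /orP[/eqP->|/IH];
  by have := h n; lra.
Qed.

Lemma in_D_ge2 n : 2 <= d n.
Proof.
by case: hd => h0 _; case: n => // n; have := in_D_add (ltn0Sn n); lra.
Qed.

Lemma param1 i : param d (T := 1) i = Complex (d i.1) 0.
Proof.
rewrite /param (ord1 i.2) /cis mul0r mulr0 cos0 sin0.
by apply/eqP; rewrite eq_complex /=; apply/andP; split; apply/eqP; ring.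
Qed.

Local Notation G := (G_system d (T := 1)).

(** From 1/(x + a) - 1/(y + a) = -(x - y) / ((x + a)(y + a)): all distance estimates below reduce to
    bounds on |z + d_n|. *)
Lemma G_distE i u v :
  0 < normc (C_of_R2 u + Complex (d i.1) 0) ->
  0 < normc (C_of_R2 v + Complex (d i.1) 0) ->
  enorm (G i u - G i v) = enorm (u - v) /
    (normc (C_of_R2 u + Complex (d i.1) 0) *
     normc (C_of_R2 v + Complex (d i.1) 0)).
Proof.
rewrite /G_system !enorm_normc !C_of_R2B !R2_of_CK /g_map param1.
move: (C_of_R2 u) (C_of_R2 v) (Complex _ _) => x y a xa ya.
have nz z : 0 < normc z -> z != 0 :> R[i].
  by apply: contraTneq => ->; rewrite normc0 ltxx.
have -> : 1 / (x + a) - 1 / (y + a) = - (x - y) / ((x + a) * (y + a)).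
  by field; rewrite !nz.
by rewrite normcM normcV normcM normcN.
Qed.

(** On this part of the disc |z + D| >= D, instead of only D - 1, so contraction by d_n^(-2) holds
    without a constant and can be iterated. *)
Definition half_disc : set 'rV[R]_2 :=
  [set v : 'rV[R]_2 | 0 <= v ord0 0 /\ enorm v <= 1].

Lemma normc_shift_le (D : R) v : 0 <= D -> closed_disc v ->
  normc (C_of_R2 v + Complex D 0) <= D + 1.
Proof.
rewrite closed_discE => D0 v1; rewrite (le_trans (le_normcD _ _))//.
by rewrite /= expr0n addr0 sqrtr_sqr ger0_norm// addrC lerD2l.
Qed.

Lemma normc_shift_ge (D : R) v : closed_disc v ->
  D - 1 <= normc (C_of_R2 v + Complex D 0).
Proof.
rewrite closed_discE => v1.
have := normc_ge_Re (C_of_R2 v); rewrite ler_norml => /andP[h _].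
have := normc_ge_Re (C_of_R2 v + Complex D 0) => /(le_trans (ler_norm _)).
by move: h v1 => /=; lra.
Qed.

Lemma normc_shift_ge_half (D : R) v : half_disc v ->
  D <= normc (C_of_R2 v + Complex D 0).
Proof.
move=> [v0 _].
have := normc_ge_Re (C_of_R2 v + Complex D 0) => /(le_trans (ler_norm _)).
by move: v0 => /=; lra.
Qed.

Lemma half_disc_sub : half_disc `<=` closed_disc.
Proof. by move=> v []. Qed.

Lemma G_half_disc i v : closed_disc v -> half_disc (G i v).
Proof.
move=> v1; have := normc_shift_ge (d i.1) v1; have := in_D_ge2 i.1 => d2 n1.
have {}n1 : 1 <= normc (C_of_R2 v + Complex (d i.1) 0) by lra.
split; last first.
  rewrite enorm_normc /G_system R2_of_CK /g_map param1 mul1r normcV.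
  by rewrite invf_le1// (lt_le_trans ltr01).
rewrite /G_system /R2_of_C mxE eqxx /g_map param1 mul1r.
move: v1; rewrite closed_discE => v1.
have := normc_ge_Re (C_of_R2 v); rewrite ler_norml => /andP[h _].
rewrite /= divr_ge0//; last by rewrite addr_ge0 ?sqr_ge0.
by move: h v1 => /=; lra.
Qed.

Lemma G_dist_half i u v : half_disc u -> half_disc v ->
  enorm (G i u - G i v) <= enorm (u - v) * d i.1 ^- 2.
Proof.
move=> u1 v1; have := in_D_ge2 i.1 => d2.
have nu := normc_shift_ge_half (d i.1) u1.
have nv := normc_shift_ge_half (d i.1) v1.
have d0 : 0 < d i.1 by lra.
rewrite G_distE ?(lt_le_trans d0)// ler_wpM2l ?enorm_ge0//.
rewrite lef_pV2 ?posrE ?mulr_gt0 ?exprn_gt0 ?(lt_le_trans d0)//.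
by rewrite expr2 ler_pM// ltW.
Qed.

(** The factor 4 comes from |z + d_n| >= d_n - 1 >= d_n / 2, which uses d_n >= 2. *)
Lemma G_dist_disc i u v : closed_disc u -> closed_disc v ->
  enorm (G i u - G i v) <= 4 * enorm (u - v) * d i.1 ^- 2.
Proof.
move=> u1 v1; have := in_D_ge2 i.1 => d2.
have nu := normc_shift_ge (d i.1) u1.
have nv := normc_shift_ge (d i.1) v1.
have d0 : 0 < d i.1 by lra.
have d1 : 0 < d i.1 - 1 by lra.
have d3 : 0 < d i.1 / 2 by lra.
rewrite G_distE ?(lt_le_trans d1)//.
have -> : 4 * enorm (u - v) * d i.1 ^- 2 =
    enorm (u - v) / ((d i.1 / 2) * (d i.1 / 2)).
  by field; lra.
rewrite ler_wpM2l ?enorm_ge0// lef_pV2 ?posrE ?mulr_gt0// ?(lt_le_trans d1)//.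
by rewrite ler_pM ?(ltW d3)//; lra.
Qed.

Lemma G_dist_ge i u v : closed_disc u -> closed_disc v ->
  enorm (u - v) * (d i.1 + 1) ^- 2 <= enorm (G i u - G i v).
Proof.
move=> u1 v1; have := in_D_ge2 i.1 => d2.
have nu := normc_shift_ge (d i.1) u1.
have nv := normc_shift_ge (d i.1) v1.
have d0 : 0 <= d i.1 by lra.
have nu' := normc_shift_le d0 u1.
have nv' := normc_shift_le d0 v1.
have d1 : 0 < d i.1 - 1 by lra.
rewrite G_distE ?(lt_le_trans d1)// ler_wpM2l ?enorm_ge0//.
have d3 : 0 < d i.1 + 1 by lra.
rewrite lef_pV2 ?posrE ?mulr_gt0 ?exprn_gt0// ?(lt_le_trans d1)//.
by rewrite expr2 ler_pM ?normc_ge0.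
Qed.

Lemma word_G_half_disc w v : half_disc v -> half_disc (word_map G w v).
Proof. by move=> v1; elim: w => //= i w /half_disc_sub; exact: G_half_disc. Qed.

Lemma word_G_dist_half w u v : half_disc u -> half_disc v ->
  enorm (word_map G w u - word_map G w v) <=
  enorm (u - v) * \prod_(i <- w) d i.1 ^- 2.
Proof.
move=> u1 v1; elim: w => [|i w IH]; first by rewrite big_nil mulr1.
rewrite big_cons/=; apply: (le_trans (G_dist_half _ _ _));
  try exact: word_G_half_disc.
by rewrite mulrCA mulrC ler_wpM2l// invr_ge0 sqr_ge0.
Qed.

Lemma word_G_dist_ge w u v : half_disc u -> half_disc v ->
  enorm (u - v) * \prod_(i <- w) (d i.1 + 1) ^- 2 <=
  enorm (word_map G w u - word_map G w v).
Proof.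
move=> u1 v1; elim: w => [|i w IH]; first by rewrite big_nil mulr1.
rewrite big_cons/=; apply: (le_trans _ (G_dist_ge _ _ _)).
- by rewrite mulrCA mulrC ler_wpM2r// invr_ge0 sqr_ge0.
- exact/half_disc_sub/word_G_half_disc.
- exact/half_disc_sub/word_G_half_disc.
Qed.

(* Only the innermost map acts on points of possibly negative real part,
   hence the constant 4 does not accumulate. *)
Lemma word_G_dist_disc w u v : closed_disc u -> closed_disc v ->
  enorm (word_map G w u - word_map G w v) <=
  8 * \prod_(i <- w) d i.1 ^- 2.
Proof.
move=> u1 v1; have uv2 : enorm (u - v) <= 2.
  rewrite (le_trans (le_enormB _ _))//.
  by move: u1 v1; rewrite /closed_disc/=; lra.
case/lastP: w => [|w i]; first by rewrite big_nil/=; lra.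
rewrite !word_map_rcons.
have /le_trans := word_G_dist_half w (G_half_disc i u1) (G_half_disc i v1).
apply.
rewrite -cats1 big_cat/= big_seq1 mulrCA mulrC ler_wpM2l//.
  by apply: prodr_ge0 => j _; rewrite invr_ge0 sqr_ge0.
have /le_trans := G_dist_disc i u1 v1; apply.
rewrite ler_wpM2r ?invr_ge0 ?sqr_ge0//.
by have := enorm_ge0 (u - v); lra.
Qed.

End InversionMaps.

(** * The Hausdorff dimensions *)

Section SimilaritySystem.
Context {R : realType} (d : nat -> R).
Hypothesis hd : in_D d.
Local Notation F := (F_system d (T := 1)).
Local Notation ratio n := (d n ^+ 2 - 1)^-1.

Definition real_point (x : R) : 'rV[R]_2 := R2_of_C (Complex x 0).

Lemma enorm_real_point (x : R) : enorm (real_point x) = `|x|.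
Proof. by rewrite enormE !mxE/= expr0n addr0 sqrtr_sqr. Qed.

Lemma real_pointB (x y : R) : real_point x - real_point y = real_point (x - y).
Proof. by apply/rowP => j; rewrite !mxE/=; case: ifP => //; rewrite subrr. Qed.

(** With real parameters the real axis is invariant, and the action there is the affine one treated
    by [coding_holder]. *)
Lemma F_real_point i x :
  F i (real_point x) = real_point (ratio i.1 * x + d i.1 / (d i.1 ^+ 2 - 1)).
Proof.
rewrite /F_system /real_point R2_of_CK /f_map param1; congr R2_of_C.
set D := d i.1; rewrite normc_def/= expr0n addr0.
rewrite (_ : Num.conj _ = (D%:C)%C); last first.
  by apply/eqP; rewrite eq_complex/= oppr0 !eqxx.
rewrite -[Complex x 0]/(x%:C)%C.
rewrite -rmorphXn sqr_sqrtr ?sqr_ge0// -(rmorph1 (real_complex R)).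
rewrite -rmorphB -rmorphD -fmorphV -rmorphM.
by congr (_%:C)%C; rewrite mulrC mulrDr [d _ / _]mulrC.
Qed.

Lemma ratio_gt0 n : 0 < ratio n.
Proof. by rewrite invr_gt0; have := in_D_ge2 hd n; nra. Qed.

Lemma ratio_le n : ratio n <= 1 / 3.
Proof.
have := in_D_ge2 hd n => d2; rewrite mul1r lef_pV2 ?posrE; nra.
Qed.

Lemma in_D_le m n : (m <= n)%N -> d m <= d n.
Proof.
by rewrite leq_eqVlt => /orP[/eqP->//|/(in_D_add hd)]; lra.
Qed.

Lemma ratio_anti m n : (m <= n)%N -> ratio n <= ratio m.
Proof.
move=> /in_D_le mn; have := in_D_ge2 hd m => d2.
by rewrite lef_pV2 ?posrE; nra.
Qed.

(* f_i [0, 1] = [1/(d_i + 1) + r_i, 1/(d_i - 1)] with r_i the ratio, and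
   1/(d_j - 1) <= 1/(d_i + 1) for i < j. *)
Lemma F_gap i j (x y : R) : (i < j)%N -> 0 <= x -> y <= 1 ->
  ratio i <= (ratio i * x + d i / (d i ^+ 2 - 1)) -
             (ratio j * y + d j / (d j ^+ 2 - 1)).
Proof.
move=> /(in_D_add hd) ij x0 y1.
have di := in_D_ge2 hd i; have dj := in_D_ge2 hd j.
have ri := ratio_gt0 i; have rj := ratio_gt0 j.
have Ei : d i / (d i ^+ 2 - 1) = (d i + 1)^-1 + ratio i.
  by field; apply/andP; split; nra.
have Ej : d j / (d j ^+ 2 - 1) = (d j - 1)^-1 - ratio j.
  by field; apply/andP; split; nra.
have Eij : (d j - 1)^-1 <= (d i + 1)^-1 by rewrite lef_pV2 ?posrE; lra.
have xi : 0 <= ratio i * x by rewrite mulr_ge0// ltW.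
have yj : ratio j * y <= ratio j by rewrite -[leRHS]mulr1 ler_wpM2l// ltW.
rewrite Ei Ej; lra.
Qed.

Lemma hausdorff_dim_F_ge M t : 0 < t -> 1 <= \sum_(n < M) ratio n `^ t ->
  (t%:E <= hausdorff_dim (limit_set closed_disc F))%E.
Proof.
move=> t0 St; apply: le_ereal_inf_tmp => _ [s [s0 Hs] <-]; rewrite lee_fin.
rewrite leNgt; apply/negP => st.
set S := \sum_(n < M) _ in St; have S0 : 0 < S by lra.
(* As S >= 1, p n <= r_n^t, and this is at most r_n^s because r_n < 1 and s < t. *)
pose p n := ratio n `^ t / S.
have p_le n : p n <= ratio n `^ t.
  by rewrite ler_pdivrMr// ler_peMr// powR_ge0.
have rdiv : forall i, (i < M)%N -> 0 <= d i / (d i ^+ 2 - 1).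
  move=> i _; rewrite mulr_ge0 ?(ltW (ratio_gt0 _))//.
  by have := in_D_ge2 hd i; lra.
(* The gap is [ratio M], a lower bound for the gaps [ratio i], i < M, of [F_gap]; the weights are at
   most (1/3)^t since the ratios are at most 1/3. *)
have [|||||||||||dig [T [X [K [K0 HX Hol]]]]] := @coding_holder R M
  (fun n => ratio n) (fun n => d n / (d n ^+ 2 - 1)) p (ratio M)
  ((1 / 3) `^ t) s.
- by move=> i _; exact: ratio_gt0.
- exact: rdiv.
- move=> i _; have di := in_D_ge2 hd i.
  rewrite (_ : _ + _ = (d i - 1)^-1); last by field; apply/andP; split; nra.
  by rewrite invf_le1; lra.
- exact: ratio_gt0.
- exact: s0.
- move=> i j x y iM jM ij /andP[x0 x1] /andP[y0 y1].
  have [lij|lji] : (i < j)%N \/ (j < i)%N.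
    by apply/orP; rewrite -neq_ltn; apply/eqP.
    rewrite (le_trans (ratio_anti (ltnW iM)))// (le_trans _ (ler_norm _))//.
    exact: F_gap.
  rewrite distrC (le_trans (ratio_anti (ltnW jM)))//.
  rewrite (le_trans _ (ler_norm _))//.
  exact: F_gap.
- by move=> i; rewrite divr_gt0// powR_gt0// ratio_gt0.
- move=> i; rewrite (le_trans (p_le i))//.
  rewrite ge0_ler_powR ?nnegrE ?(ltW t0) ?(ltW (ratio_gt0 _))//.
  exact: ratio_le.
- have := @gt0_ltr_powR R t t0 (1 / 3) 1; rewrite powR1.
  by apply; rewrite ?nnegrE; lra.
- move=> i _; rewrite (le_trans (p_le i))//.
  rewrite ger_powR ?ratio_gt0//=; last exact: ltW.
  by have := ratio_le i; lra.
- by rewrite -mulr_suml divff// gt_eqF.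
have TX n y : 0 <= y <= 1 -> 0 <= iter n T y <= 1.
  by move=> y01; elim: n => //= n /HX[].
(* The digits along the orbit of y under [T] form an address of X y in the limit set: after N
   letters the point that remains is X at the N-th iterate of y. *)
pose w y n : nat * 'I_1 := (dig (iter n T y), ord0).
have wE N y : 0 <= y <= 1 -> real_point (X y) =
    word_map F (mkseq (w y) N) (real_point (X (iter N T y))).
  move=> y01; elim: N => [//|N ->]; rewrite mkseqS word_map_rcons.
  rewrite F_real_point/=.
  by have [_ _ _ ->] := HX _ (TX N y y01); congr (word_map _ _ (real_point _)).
have := @hausdorff_measure_holder_neq0 R 2 (limit_set closed_disc F)
  (fun y => real_point (X y)) K s K0 s0; rewrite Hs eqxx => H.
suff : false by []; apply: H.
  move=> y y01; exists (w y) => // N _; exists (real_point (X (iter N T y))).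
    have [_ _ /andP[X0 X1] _] := HX _ (TX N y y01).
    by rewrite /closed_disc/= enorm_real_point ger0_norm.
  by rewrite -wE.
by move=> y y' y01 y01'; rewrite real_pointB enorm_real_point; exact: Hol.
Qed.

End SimilaritySystem.

(** * Upper bound for the dimension of the limit set of G *)

Section InversionUpperBound.
Context {R : realType} (d : nat -> R).
Hypothesis hd : in_D d.
Local Notation G := (G_system d (T := 1)).

Lemma prod_inv_sq_le (w : seq (nat * 'I_1)) :
  \prod_(i <- w) d i.1 ^- 2 <= 4^-1 ^+ size w.
Proof.
elim: w => [|i w IH]; first by rewrite big_nil.
rewrite big_cons/= [leRHS]exprS ler_pM ?invr_ge0 ?sqr_ge0//.
  by apply: prodr_ge0 => j _; rewrite invr_ge0 sqr_ge0.
by have := in_D_ge2 hd i.1 => d2; rewrite lef_pV2 ?posrE; nra.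
Qed.

Lemma ediam_word_G w : (ediam (word_map G w @` closed_disc) <=
  (8 * \prod_(i <- w) d i.1 ^- 2)%:E)%E.
Proof.
apply: ge_ereal_sup => _ [[_ _] [/= [x x1 <-] [y y1 <-]] <-].
by rewrite lee_fin; exact: word_G_dist_disc.
Qed.

(** The images of the disc under all words of length N cover the limit set. The t-th powers of their
    diameter bounds factor over the letters and sum to 8^t q^N, where q < 1 is the given series. *)
Lemma hausdorff_dim_G_le t : 0 < t ->
  (\sum_(n <oo) ((d n ^- 2) `^ t)%:E < 1)%E ->
  (hausdorff_dim (limit_set closed_disc G) <= t%:E)%E.
Proof.
move=> t0 St1; apply: ereal_inf_lbound; exists t => //; split; first exact: ltW.
have a0 n : 0 <= d n ^- 2 by rewrite invr_ge0 sqr_ge0.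
have S0 : (0 <= \sum_(n <oo) ((d n ^- 2) `^ t)%:E)%E.
  by apply: nneseries_ge0 => n _ _; rewrite lee_fin powR_ge0.
have [q qE] : exists q, (\sum_(n <oo) ((d n ^- 2) `^ t)%:E = q%:E)%E.
  exists (fine (\sum_(n <oo) ((d n ^- 2) `^ t)%:E)%E).
  by rewrite fineK// ge0_fin_numE// (lt_trans St1)// ltry.
move: S0 St1; rewrite qE lee_fin lte_fin => q0 q1.
apply/eqP; rewrite eq_le; apply/andP; split; last first.
  apply: le_trans (ereal_sup_ubound _); last by exists 1 => //=; exact: ltr01.
  apply: le_ereal_inf_tmp => _ [U _ <-].
  by apply: nneseries_ge0 => n _ _; exact: diam_pow_ge0.
apply: ge_ereal_sup => _ [e /= e0 <-].
apply/lee_addgt0Pr => r r0; rewrite add0e.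
(* The thresholds ask for 8 * 4^-N < e, for the diameters, and 8^t q^N < r, for the sum. *)
have e8 : 0 < e / 8 by rewrite divr_gt0.
have r8 : 0 < r / 8 `^ t by rewrite divr_gt0// powR_gt0.
have : (4^-1 ^+ n : R) @[n --> \oo] --> 0.
  by apply: cvg_expr; rewrite ger0_norm ?invr_ge0//; lra.
move/cvgrPdist_lt => /(_ _ e8) [N1 _ HN1].
have : (q ^+ n : R) @[n --> \oo] --> 0 by apply: cvg_expr; rewrite ger0_norm.
move/cvgrPdist_lt => /(_ _ r8) [N2 _ HN2].
(* The successor makes N positive, as the intersections in [limit_set] require. *)
pose N := (maxn N1 N2).+1.
have {HN1} := HN1 N (leqW (leq_maxl _ _)).
have {HN2} := HN2 N (leqW (leq_maxr _ _)).
rewrite /= !sub0r !normrN ger0_norm ?exprn_ge0//.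
rewrite ger0_norm ?exprn_ge0 ?invr_ge0//.
have N0 : (0 < N)%N by [].
move: N N0 => N N0 HN2 HN1.
(* Integers that code no word get the empty set, of diameter -oo and of [diam_pow] 0. *)
pose U n : set 'rV[R]_2 := if @pickle_inv (N.-tuple (nat * 'I_1)) n is Some w
  then word_map G w @` closed_disc else set0.
pose b (w : N.-tuple (nat * 'I_1)) := 8 * \prod_(i <- w) d i.1 ^- 2.
have b0 w : 0 <= b w by rewrite mulr_ge0//; apply: prodr_ge0 => i _.
apply: (@le_trans _ _ (\sum_(n <oo) diam_pow t (U n))%E).
  apply: ereal_inf_lbound; exists U => //; split.
    move=> x [w _ wN]; have wx := wN N N0.
    exists (pickle [tuple of mkseq w N]) => //.
    by rewrite /U pickleK_inv.
  move=> n; rewrite /U; case: pickle_inv => [w|].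
    apply: (le_trans (ediam_word_G _)); rewrite lee_fin.
    have := prod_inv_sq_le w; rewrite size_tuple; lra.
  rewrite /ediam (_ : [set _ | _ in _] = set0) ?ereal_sup0 ?leNye//.
  by apply/seteqP; split => // x [? []].
apply: (@le_trans _ _ (\sum_(n <oo) (if @pickle_inv (N.-tuple (nat * 'I_1)) n
    is Some w then (b w `^ t)%:E else 0))%E).
  apply: lee_nneseries => [n _ _|n _]; first exact: diam_pow_ge0.
  rewrite /U; case: pickle_inv => [w|]; last first.
    by rewrite /diam_pow; case: asboolP.
  rewrite /diam_pow; case: asboolP => [_|ne]; first by rewrite lee_fin powR_ge0.
  have [v Uv] : (word_map G w @` closed_disc) !=set0 by apply/set0P/eqP.
  rewrite -poweR_EFin gt0_ler_poweR ?ediam_word_G ?(ltW t0)// in_itv/= leey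
    andbT.
    by apply: le_trans (enorm_le_ediam Uv Uv); rewrite lee_fin enormB_ge0.
  by rewrite lee_fin.
rewrite (nneseries_pickle (f := fun w => (b w `^ t)%:E)); last first.
  by move=> w; rewrite lee_fin powR_ge0.
under eq_esum => w _.
  rewrite /b powRM//; last by apply: prodr_ge0 => i _.
  rewrite EFinM; over.
rewrite ge0_esumZl ?lee_fin ?powR_ge0//; last first.
  by move=> w; rewrite lee_fin powR_ge0.
rewrite (esum_word_powR (a := fun n => d n ^- 2))// qE -EFin_expe.
rewrite -EFinM lee_fin.
by move: HN2; rewrite ltr_pdivlMr ?powR_gt0// mulrC => /ltW.
Qed.

End InversionUpperBound.

(** * Pressure *)

Section ConformalDerivative.
Context {R : realType}.
Implicit Types (u v : 'rV[R]_2) (f : 'rV[R]_2 -> 'rV[R]_2).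

Lemma continuous_enorm : continuous (enorm : 'rV[R]_2 -> R).
Proof.
move=> v; have -> : (enorm : 'rV[R]_2 -> R) =
    Num.sqrt \o (fun v : 'rV[R]_2 => v ord0 0 ^+ 2 + v ord0 1 ^+ 2).
  by apply/funext => w; rewrite /= enormE.
apply: continuous_comp; last exact: sqrt_continuous.
have cf (j : 'I_2) : {for v, continuous (fun v : 'rV[R]_2 => v ord0 j ^+ 2)}.
  apply: (@continuous_comp _ _ _
    (fun v : 'rV[R]_2 => v ord0 j) (fun x => x ^+ 2)).
    exact: coord_continuous.
  exact: exprn_continuous.
exact: (continuousD (cf 0) (cf 1)).
Qed.

Lemma opnorm_similarity f (r : R) : 0 <= r ->
  (forall v, enorm (f v) = r * enorm v) -> opnorm f = r.
Proof.
move=> r0 fE; apply/eqP; rewrite eq_le; apply/andP; split.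
  apply: ge_sup; first by exists (enorm (f 0)), 0 => //=; rewrite enorm0.
  by move=> _ [v /= v1 <-]; rewrite fE -[leRHS]mulr1 ler_wpM2l.
apply: ub_le_sup.
  by exists r => _ [v /= v1 <-]; rewrite fE -[leRHS]mulr1 ler_wpM2l.
by exists (real_point 1); rewrite /= ?fE enorm_real_point normr1 ?mulr1.
Qed.

(** Only h > 0 is used: 0 lies on the boundary of [half_disc], where the estimates for G words are
    available on one side only. *)
Lemma enorm_diff_bounds f v (A B : R) : differentiable f 0 ->
  (forall h, 0 < h < 1 -> A * h <= enorm (f (h *: v) - f 0) <= B * h) ->
  A <= enorm ('d f 0 v) <= B.
Proof.
move=> df H; have := @diff_derivable _ _ _ f 0 v df => /cvg_ex[l lE].
have -> : 'd f 0 v = l by rewrite -deriveE//; exact: cvg_lim lE.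
have {}lE : enorm (h^-1 *: (f (h *: v) - f 0)) @[h --> 0^'+] --> enorm l.
  apply: (continuous_cvg _ (@continuous_enorm l)).
  have := cvg_dnbhs_at_right lE; apply: cvg_trans; apply: near_eq_cvg.
  by apply: nearW => h /=; rewrite addr0.
have near01 : \forall h \near (0 : R)^'+,
    A <= enorm (h^-1 *: (f (h *: v) - f 0)) <= B.
  near=> h; have h0 : 0 < h by near: h; exact: nbhs_right_gt.
  have h1 : h < 1 by near: h; exact: nbhs_right_lt.
  have /andP[H1 H2] : A * h <= enorm (f (h *: v) - f 0) <= B * h.
    by rewrite H ?h0.
  rewrite enormZ gtr0_norm ?invr_gt0// [_^-1 * _]mulrC.
  by rewrite ler_pdivlMr// H1 ler_pdivrMr.
apply/andP; split.
  by apply: cvgr_to_ge lE _; apply: filterS near01 => h /andP[].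
by apply: cvgr_to_le lE _; apply: filterS near01 => h /andP[].
Unshelve. all: by end_near.
Qed.

(** Chain rule: the orbit of x stays in V, and similarity ratios multiply. *)
Lemma word_map_conformal (I : countType) (S : I -> 'rV[R]_2 -> 'rV[R]_2) V w x :
  (forall i, S i @` V `<=` V) -> (forall i y, V y -> differentiable (S i) y) ->
  (forall i, conformal_on V (S i)) -> V x ->
  [/\ V (word_map S w x), differentiable (word_map S w) x &
    exists2 r, 0 < r & forall v, enorm ('d (word_map S w) x v) = r * enorm v].
Proof.
move=> SV dS cS Vx; elim: w => [|i w [Vw dw [r r0 wE]]] /=.
  have dE := @diff_val _ _ _ _ _ _ _ (is_diff_id x).
  have di : differentiable (id : 'rV[R]_2 -> 'rV[R]_2) x.
    exact: (@ex_diff _ _ _ _ _ _ _ (is_diff_id x)).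
  split; [exact: Vx|exact: di|exists 1; [exact: ltr01|]].
  by move=> v; rewrite dE mul1r.
split; [by apply: (SV i); exists (word_map S w x)| |].
  by apply: differentiable_comp => //; exact: dS.
have [r' r'0 E] := cS i _ Vw; exists (r' * r); first exact: mulr_gt0.
have dc := diff_comp dw (dS i _ Vw).
by move=> v; rewrite dc [enorm _]E wE mulrA.
Qed.

Lemma word_map_ext (I : countType) (s S : I -> 'rV[R]_2 -> 'rV[R]_2) X w x :
  (forall i, s i @` X `<=` X) -> (forall i y, X y -> S i y = s i y) -> X x ->
  word_map S w x = word_map s w x /\ X (word_map s w x).
Proof.
move=> sX Ss Xx; elim: w => //= i w [-> Xw].
by split; [exact: Ss|apply: (sX i); exists (word_map s w x)].
Qed.

End ConformalDerivative.

(** * Partition sums of G and the zero of its pressure *)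

Section Pressure.
Context {R : realType} (d : nat -> R).
Hypothesis hd : in_D d.
Local Notation G := (G_system d (T := 1)).
Local Notation disc := (closed_disc : set 'rV[R]_2).

Lemma real_point0 : real_point 0 = 0 :> 'rV[R]_2.
Proof. by apply/rowP => j; rewrite !mxE/=; case: ifP. Qed.

Lemma scale_real_point (h : R) : h *: real_point 1 = real_point h.
Proof.
by apply/rowP => j; rewrite !mxE/=; case: ifP; rewrite ?mulr1 ?mulr0.
Qed.

Lemma real_point_half (x : R) : 0 <= x <= 1 -> half_disc (real_point x).
Proof.
move=> /andP[x0 x1]; split; first by rewrite mxE.
by rewrite enorm_real_point ger0_norm.
Qed.

Lemma G_maps i : G i @` disc `<=` disc.
Proof. by move=> _ [v v1 <-]; exact/half_disc_sub/G_half_disc. Qed.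

Section Extension.
Variables (V : set 'rV[R]_2) (S : nat * 'I_1 -> 'rV[R]_2 -> 'rV[R]_2).
Hypothesis GS : CIFS_extension disc V G S.

Lemma opnorm_word_at w x : V x -> exists2 r, 0 < r &
  [/\ differentiable (word_map S w) x, opnorm ('d (word_map S w) x) = r &
      forall v, enorm ('d (word_map S w) x v) = r * enorm v].
Proof.
case: GS => _ _ _ [_ _ _ _ SV [e e0 Se] Sc] _ Vx.
have dS i y : V y -> differentiable (S i) y.
  by case: (Se i) => [[+ _] _ _]; exact.
have [_ dw [r r0 wE]] := word_map_conformal w SV dS Sc Vx.
by exists r => //; split => //; apply: opnorm_similarity => //; exact: ltW.
Qed.

Lemma disc_sub_V : disc `<=` V.
Proof. by case: GS => _ _ _ []. Qed.

(** The derivative is a similarity, so its norm can be read off in the direction of the positive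
    real axis. Along that half-line, near 0, the extension agrees with the G words and the
    [half_disc] estimates apply. *)
Lemma opnorm_word_bounds w :
  \prod_(i <- w) (d i.1 + 1) ^- 2 <= opnorm ('d (word_map S w) 0) <=
  \prod_(i <- w) d i.1 ^- 2.
Proof.
have disc0 : disc 0 by rewrite /closed_disc/= enorm0.
have [r r0 [dw -> wE]] := opnorm_word_at w (disc_sub_V disc0).
have <- : enorm ('d (word_map S w) 0 (real_point 1)) = r.
  by rewrite wE enorm_real_point normr1 mulr1.
apply: enorm_diff_bounds => // h /andP[h0 h1].
rewrite scale_real_point; have h01 : 0 <= h <= 1 by rewrite !ltW.
have r01 : 0 <= (0 : R) <= 1 by rewrite lexx/= ler01.
have ext x : 0 <= x <= 1 ->
    word_map S w (real_point x) = word_map G w (real_point x).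
  move=> /real_point_half/half_disc_sub x1.
  case: GS => _ _ _ [_ _ _ eqS _ _ _] _.
  by have [] := word_map_ext w G_maps eqS x1.
rewrite -real_point0 !ext//.
have := word_G_dist_ge hd w (real_point_half h01) (real_point_half r01).
have := word_G_dist_half hd w (real_point_half h01) (real_point_half r01).
rewrite real_pointB subr0 enorm_real_point gtr0_norm//.
by rewrite ![h * _]mulrC => -> ->.
Qed.

Local Notation partition t N := (\esum_(w in [set: N.-tuple (nat * 'I_1)])
  ereal_sup [set (opnorm ('d (word_map S w) x) `^ t)%:E | x in disc])%E.

Lemma partition_ge t N : 0 <= t ->
  ((\sum_(n <oo) (((d n + 1) ^- 2) `^ t)%:E) ^+ N <= partition t N)%E.
Proof.
move=> t0; rewrite -esum_word_powR; last by move=> n; rewrite invr_ge0 sqr_ge0.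
apply: le_esum => w _.
apply: (@le_trans _ _ (opnorm ('d (word_map S w) 0) `^ t)%:E).
  have p0 : 0 <= \prod_(i <- w) (d i.1 + 1) ^- 2.
    by apply: prodr_ge0 => i _; rewrite invr_ge0 sqr_ge0.
  have /andP[H _] := opnorm_word_bounds w.
  by rewrite lee_fin ge0_ler_powR ?nnegrE// (le_trans p0).
by apply: ereal_sup_ubound; exists 0 => //; rewrite /closed_disc/= enorm0.
Qed.

(** Bounded distortion transfers the estimate at 0 to the whole disc at the cost of one factor K,
    independent of N, which disappears in the pressure limit. *)
Lemma partition_le t : 0 <= t -> exists2 K : R, 1 <= K & forall N, (0 < N)%N ->
  (partition t N <= (K `^ t)%:E * (\sum_(n <oo) ((d n ^- 2) `^ t)%:E) ^+ N)%E.
Proof.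
move=> t0; case: (GS) => _ _ _ _ [K K1 HK]; exists K => // N N0.
have disc0 : disc 0 by rewrite /closed_disc/= enorm0.
have a0 n : 0 <= d n ^- 2 by rewrite invr_ge0 sqr_ge0.
rewrite -esum_word_powR// -ge0_esumZl ?lee_fin ?powR_ge0//; last first.
  by move=> w; rewrite lee_fin powR_ge0.
apply: le_esum => w _; apply: ge_ereal_sup => _ [x x1 <-].
rewrite -EFinM lee_fin.
have [r r0 [_ rE _]] := opnorm_word_at w (disc_sub_V x1).
have p0 : 0 <= \prod_(i <- w) d i.1 ^- 2 by apply: prodr_ge0 => i _.
have K0 : 0 <= K by rewrite (le_trans ler01).
rewrite -powRM// ge0_ler_powR ?nnegrE ?mulr_ge0 ?rE ?(ltW r0)// -rE.
have w0 : (w : seq _) != [::] by rewrite -size_eq0 size_tuple -lt0n.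
rewrite (le_trans (HK _ _ _ w0 (disc_sub_V disc0) (disc_sub_V x1)))//.
by rewrite ler_wpM2l//; have /andP[] := opnorm_word_bounds w.
Qed.

End Extension.

Lemma regular_exponent : is_regular disc G -> exists h : R, [/\ 0 < h,
  (\sum_(n <oo) ((d n ^- 2) `^ h)%:E < +oo)%E &
  (1 <= \sum_(n <oo) ((d n ^- 2) `^ h)%:E)%E].
Proof.
move=> [h h0 [V [S [GS /fine_cvgP[fin cv]]]]].
set q := (\sum_(n <oo) ((d n ^- 2) `^ h)%:E)%E.
have a0 n : 0 < d n ^- 2 by rewrite invr_gt0; have := in_D_ge2 hd n; nra.
have q0 : (0 <= q)%E by apply: nneseries_ge0 => n _ _; rewrite lee_fin powR_ge0.
have qoo : (q < +oo)%E.
  (* Since d_n + 1 <= 2 d_n, divergence passes to the series of (d_n + 1)^(-2h), which bounds the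
     partition sums below. The pressure sequence would then be infinite, although it is eventually
     finite. *)
  rewrite ltNge leye_eq; apply/negP => /eqP qE.
  have q'E : (\sum_(n <oo) (((d n + 1) ^- 2) `^ h)%:E = +oo)%E.
    apply/eqP; rewrite -leye_eq.
    rewrite -(@gt0_muley _ ((4^-1 `^ h)%:E : \bar R)); last first.
      by rewrite lte_fin powR_gt0// invr_gt0.
    rewrite -qE /q -nneseriesZl; last by move=> n _; rewrite lee_fin powR_ge0.
    apply: lee_nneseries => n _.
      by rewrite -EFinM lee_fin mulr_ge0 ?powR_ge0.
    rewrite -EFinM lee_fin -powRM ?invr_ge0 ?sqr_ge0//.
    have d2 := in_D_ge2 hd n.
    rewrite ge0_ler_powR ?nnegrE ?mulr_ge0 ?invr_ge0 ?sqr_ge0//.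
    by rewrite -invfM lef_pV2 ?posrE; nra.
  (* A positive rank is needed: the zeroth power of +oo is 1. *)
  case: fin => N _ /(_ N.+1 (leqnSn _)); rewrite /pressure_seq.
  have := partition_ge GS N.+1 h0; rewrite q'E.
  have -> : (+oo ^+ N.+1 = +oo :> \bar R)%E.
    by elim: N => // N IH; rewrite expeS IH gt0_muley.
  rewrite leye_eq => /eqP -> /=.
  by rewrite gt0_muley// lte_fin invr_gt0 ltr0n.
(* At h = 0 every term is 1, so k > q terms already exceed the finite sum q. *)
have hpos : 0 < h.
  rewrite lt_neqAle h0 andbT; apply/negP => /eqP hE.
  pose k := (Num.truncn (fine q)).+1.
  have : (\sum_(0 <= n < k) ((d n ^- 2) `^ h)%:E <= q)%E.
    by apply: nneseries_lim_ge => n _ _; rewrite lee_fin powR_ge0.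
  rewrite -hE; under eq_bigr do rewrite powRr0.
  rewrite sumEFin big_const_nat subn0 iter_addr addr0 leNgt => /negP; apply.
  rewrite -(@fineK _ q) ?ge0_fin_numE// lte_fin.
  exact: truncnS_gt.
exists h; split => //; rewrite leNgt; apply/negP => q1.
have [K K1 HK] := partition_le GS h0.
have [p pE] : exists p, q = p%:E.
  by exists (fine q); rewrite fineK// ge0_fin_numE.
have p0 : 0 < p.
  rewrite -lte_fin -pE (@lt_le_trans _ _ ((d 0%N ^- 2) `^ h)%:E)//.
    by rewrite lte_fin powR_gt0.
  have := @nneseries_lim_ge R (fun n => ((d n ^- 2) `^ h)%:E) xpredT 0 1.
  by rewrite big_nat1; apply => n _ _; rewrite lee_fin powR_ge0.
have p1 : p < 1 by rewrite -lte_fin -pE.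
have lnp : ln p < 0 by exact: ln_lt0 (introT andP (conj p0 p1)).
have lnK : 0 <= ln K by rewrite ln_ge0.
case: fin => N1 _ fin.
(* If p < 1, the N-th pressure term is at most h ln K / N + ln p. The N below makes the first
   summand less than -ln p / 2, so the term stays below ln p / 2 < 0 and cannot tend to 0. *)
have lnp2 : 0 < - ln p / 2 by rewrite divr_gt0 ?oppr_gt0.
move/cvgrPdist_lt : cv => /(_ _ lnp2) [N2 _ cv].
pose N := (maxn (maxn N1 N2) (Num.truncn (2 * (h * ln K) / - ln p))).+1.
have N1N : (N1 <= N)%N by rewrite leqW// !leq_max leqnn.
have N2N : (N2 <= N)%N by rewrite leqW// !leq_max leqnn orbT.
have N3N : 2 * (h * ln K) < N%:R * - ln p.
  rewrite -ltr_pdivrMr ?oppr_gt0// (lt_le_trans (truncnS_gt _))// ler_nat.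
  by rewrite ltnS leq_max leqnn orbT.
have N0 : (0 < N)%N by [].
move: N N0 N1N N2N N3N => N N0 N1N N2N N3N.
have NR : 0 < N%:R :> R by rewrite ltr0n.
have Kp : 0 < K `^ h by rewrite powR_gt0// (lt_le_trans ltr01).
have pN : 0 < p ^+ N by rewrite exprn_gt0.
have := cv N N2N; rewrite /= sub0r normrN; apply/negP; rewrite -leNgt.
have le1 : fine (pressure_seq disc S h N) <= N%:R^-1 * (h * ln K + N%:R * ln p).
  rewrite -lee_fin fineK; last exact: fin.
  rewrite /pressure_seq EFinM lee_wpmul2l ?lee_fin ?invr_ge0//.
  apply: (@le_trans _ _ (lne ((K `^ h * p ^+ N)%:E))).
    rewrite lee_lne.
    - by have := HK N N0; rewrite -/q pE -EFin_expe -EFinM.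
    - rewrite in_itv/= leey andbT; apply: esum_ge0 => w _.
      apply: le_trans (ereal_sup_ubound _); last first.
        by exists 0 => //; rewrite /closed_disc/= enorm0.
      by rewrite lee_fin powR_ge0.
    - by rewrite in_itv/= leey andbT lee_fin mulr_ge0 ?ltW.
  rewrite lne_EFin ?mulr_gt0// lnM ?posrE// ln_powR lnXn// lee_fin.
  by rewrite mulr_natl.
rewrite ler_normr; apply/orP; right; rewrite lerNr (le_trans le1)//.
rewrite ler_pdivrMl//.
move: N3N; move: (h * ln K) (N%:R) (ln p) => a b c; nra.
Qed.

End Pressure.

Theorem theorem5 (R : realType) (d : nat -> R) (hd : in_D d)
    (hF : is_CIFS closed_disc (F_system d (T := 1)))
    (hG : is_CIFS closed_disc (G_system d (T := 1)))
    (hGreg : is_regular closed_disc (G_system d (T := 1))) :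
  (hausdorff_dim (limit_set closed_disc (G_system d (T := 1))) <
   hausdorff_dim (limit_set closed_disc (F_system d (T := 1))))%E.
Proof.
have [h [h0 qoo q1]] := regular_exponent hd hGreg.
have [n|n||t0 [t1 [M [ht0 t01 SM S1]]]] := @exponent_gap R (fun n => d n ^- 2)
  (fun n => (d n ^+ 2 - 1)^-1) h h0 _ _ _ qoo q1.
- have d2 := in_D_ge2 hd n.
  by rewrite invr_gt0 mul1r lef_pV2 ?posrE; nra.
- by have d2 := in_D_ge2 hd n; rewrite lef_pV2 ?posrE; nra.
- by have d2 := in_D_ge2 hd 0; rewrite ltf_pV2 ?posrE; nra.
(* The midpoint lies strictly above t0, where the series of d_n^(-2t) is below 1, and strictly below
   t1. *)
apply: (@le_lt_trans _ _ ((t0 + t1) / 2)%:E).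
  by apply: hausdorff_dim_G_le => //; [lra|apply: S1; lra].
apply: (@lt_le_trans _ _ t1%:E); first by rewrite lte_fin; lra.
by apply: (hausdorff_dim_F_ge hd _ SM); lra.
Qed.
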